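(* Let $m$ and $g$ be positive integers with $2\leq m\leq g$, and let $\mathcal B_{m,g}:=\big\{F\in\{\lceil\frac{mg}{m-1}\rceil-1,\ldots,2g-1\}\mid m\nmid F\big\}$. Then $$\widehat{\mathscr L}(m,g)=\bigcup_{F\in\mathcal B_{m,g}}\widehat{\mathscr L}(m,g,F).$$
   Context: $\mathbb N$ denotes the non-negative integers. A numerical semigroup is a submonoid $S$ of $(\mathbb N,+)$ with $\mathbb N\setminus S$ finite. Its multiplicity is the smallest positive integer in $S$; its Frobenius number is the largest integer not in $S$; its genus is the cardinality of $\mathbb N\setminus S$. $\widehat{\mathscr L}(m,g)$ is the set of all numerical semigroups with multiplicity $m$ and genus $g$, and $\widehat{\mathscr L}(m,g,F)$ is the set of all numerical semigroups with multiplicity $m$, genus $g$ and Frobenius number $F$. *)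

(* Defs.v *)
From mathcomp Require Import all_boot all_order all_algebra finmap.
From mathcomp Require Import boolp classical_sets functions cardinality.

Set Implicit Arguments.
Unset Strict Implicit.
Unset Printing Implicit Defensive.

Import Order.TTheory GRing.Theory Num.Theory.

Local Open Scope classical_set_scope.
Local Open Scope ring_scope.

Definition numerical_semigroup (S : set nat) : Prop :=
  [/\ S 0%N,
      forall x y : nat, S x -> S y -> S (x + y)%N
    & finite_set (~` S)].

Definition is_multiplicity (S : set nat) (m : nat) : Prop :=
  [/\ (0 < m)%N, S m & forall x : nat, S x -> (0 < x)%N -> (m <= x)%N].

(* The maximum is taken over all integers, so that the Frobenius number of
   [setT] is -1. *)
Definition is_frobenius (S : set nat) (F : int) : Prop :=
  let SZ : set int := [set n%:Z | n in S] in
  ~ SZ F /\ forall z : int, ~ SZ z -> z <= F.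

(* [fset_set] of an infinite set is empty; [genus] is only meaningful when the
   complement of [S] is finite. *)
Definition genus (S : set nat) : nat := #|` fset_set (~` S)|%fset.

Definition Lhat (m g : nat) : set (set nat) :=
  [set S | [/\ numerical_semigroup S, is_multiplicity S m & genus S = g]].

Definition LhatF (m g : nat) (F : int) : set (set nat) :=
  [set S | [/\ numerical_semigroup S, is_multiplicity S m, genus S = g
             & is_frobenius S F]].

Definition Bset (m g : nat) : set int :=
  [set F | Num.ceil ((m%:R * g%:R) / (m%:R - 1) : rat) - 1 <= F
             <= 2 * g%:Z - 1
           /\ ~~ (m%:Z %| F)%Z].

(* Main.v *)
Require Import Defs.
From mathcomp Require Import all_boot all_order all_algebra finmap.
From mathcomp Require Import boolp classical_sets functions cardinality.
From mathcomp Require Import zify.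

(* Write F for the largest gap. For 0 <= x <= F one of x, F - x is a gap, so
   F + 1 <= 2g. The gaps and the F %/ m + 1 multiples of m in [0, F] are
   disjoint subsets of [0, F], so g + F %/ m <= F; as F %% m <= m - 1, this
   gives m g <= (m - 1)(F + 1). *)

Import Order.TTheory GRing.Theory Num.Theory.

Local Open Scope classical_set_scope.

Lemma in_gapsP (S : set nat) (x : nat) :
  numerical_semigroup S -> reflect (~ S x) (x \in fset_set (~` S)).
Proof. by case=> _ _ fS; rewrite in_fset_set //; apply: (iffP idP); rewrite inE. Qed.

Lemma numerical_semigroupM (S : set nat) (m k : nat) :
  numerical_semigroup S -> S m -> S (k * m)%N.
Proof.
by case=> S0 SD _ Sm; elim: k => [|k IH]; rewrite ?mul0n // mulSn; apply: SD.
Qed.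

Lemma in_fset_iota (n x : nat) : (x \in [fset y in iota 0 n]%fset) = (x < n)%N.
Proof. by rewrite in_fset mem_iota add0n. Qed.

Lemma card_fset_iota (n : nat) : #|` [fset x in iota 0 n]%fset| = n.
Proof. by rewrite card_fseq undup_id ?iota_uniq // size_iota. Qed.

(** The gaps are finite in number, hence bounded; the given gap [x] only ensures that there is one
    to maximise over. *)
Lemma max_gap_exists (S : set nat) (x : nat) :
  numerical_semigroup S -> ~ S x ->
  exists2 F : nat, ~ S F & forall y, ~ S y -> (y <= F)%N.
Proof.
move=> nS nSx; set G := fset_set (~` S).
have exG : exists y, y \in G by exists x; apply/in_gapsP.
have ubG y : y \in G -> (y <= \max_(z <- G) z)%N.
  by move=> Gy; exact: (@leq_bigmax_seq _ (enum_fset G) xpredT id y Gy isT).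
case: (ex_maxnP exG ubG) => F /in_gapsP GF maxF.
by exists F => [|y nSy]; [exact: GF | apply/maxF/in_gapsP].
Qed.

Lemma max_gap_le_genus (S : set nat) (F : nat) :
  numerical_semigroup S -> ~ S F -> (F.+1 <= 2 * genus S)%N.
Proof.
move=> nS nSF; rewrite /genus; set G := fset_set (~` S).
have sub : ([fset x in iota 0 F.+1] `<=` G `|` [fset (F - x)%N | x in G])%fset.
  apply/fsubsetP => x; rewrite in_fset_iota ltnS in_fsetU => xF.
  case: (boolP (x \in G)) => //= /(in_gapsP _ _ nS) /contrapT Sx.
  (* With [x] in [S], its reflection [F - x] must be a gap, since otherwise [F = (F - x) + x] would
     lie in [S]. *)
  apply/imfsetP; exists (F - x)%N; last by rewrite /= subKn.
  apply/in_gapsP => // SFx; apply: nSF; rewrite -(subnK xF).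
  by case: nS => _ SD _; apply: SD.
have := fsubset_leq_card sub; rewrite card_fset_iota => /leq_trans; apply.
(* [G] and its reflection may overlap; the intersection term is dropped, as only an upper bound is
   needed. *)
rewrite cardfsU (leq_trans (leq_subr _ _)) // mul2n -addnn leq_add2l.
exact: leq_imfset_card.
Qed.

Lemma genus_add_div_le (S : set nat) (m F : nat) :
  numerical_semigroup S -> (0 < m)%N -> S m ->
  (forall x, ~ S x -> (x <= F)%N) -> (genus S + F %/ m <= F)%N.
Proof.
move=> nS m0 Sm maxF; rewrite /genus; set G := fset_set (~` S).
pose M := [fset (k * m)%N | k in [fset x in iota 0 (F %/ m).+1]]%fset.
have cM : #|` M| = (F %/ m).+1.
  rewrite card_imfset ?card_fset_iota // => a b /= /eqP.
  by rewrite eqn_pmul2r // => /eqP.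
have GM0 : (G `&` M = fset0)%fset.
  apply/fsetP => x; rewrite !inE; apply/negP => /andP[/(in_gapsP _ _ nS) nSx].
  by case/imfsetP => k _ xE; apply: nSx; rewrite xE; apply: numerical_semigroupM.
have sub : (G `|` M `<=` [fset x in iota 0 F.+1])%fset.
  apply/fsubsetP => x; rewrite in_fsetU in_fset_iota ltnS.
  case/orP=> [/(in_gapsP _ _ nS) /maxF //|/imfsetP[k kM ->]].
  have : k \in [fset y in iota 0 (F %/ m).+1]%fset by exact: kM.
  by rewrite in_fset_iota ltnS leq_divRL.
have := fsubset_leq_card sub.
(* The extra 1 in [cM], due to the multiple 0, cancels the one in [F.+1]. *)
by rewrite cardfsU GM0 cardfs0 subn0 cM card_fset_iota addnS ltnS.
Qed.

Lemma is_frobenius_nat (S : set nat) (F : nat) :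
  ~ S F -> (forall x, ~ S x -> (x <= F)%N) -> is_frobenius S F%:Z.
Proof.
(* The maximality clause ranges over [int]: negative [z] lie below [F%:Z] at once, and only the
   others call on [maxF]. *)
move=> nSF maxF; split=> [[n Sn [nF]]|[n|n] nSz].
- by apply: nSF; rewrite -nF.
- by rewrite lez_nat; apply: maxF => Sn; apply: nSz; exists n.
- by [].
Qed.

Lemma ceil_div_sub1_le (m g F : nat) :
  (1 < m)%N -> (g + F %/ m <= F)%N ->
  (Num.ceil ((m%:R * g%:R) / (m%:R - 1) : rat) - 1 <= F%:Z)%R.
Proof.
(* Since [F + 1] is an integer, the ceiling may be dropped, leaving a rational inequality to clear
   of its positive denominator. *)
move=> m1 gF; rewrite lerBlDr ceil_le_int.
have m1E : (m%:R - 1 = m.-1%:R :> rat)%R by rewrite -subn1 natrB // ltnW.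
rewrite m1E ler_pdivrMr ?ltr0n; last by lia.
rewrite [X in (_ <= X * _)%R](_ : _ = F.+1%:R%R); last first.
  by rewrite -[RHS]natr1 intrD.
rewrite -!natrM ler_nat.
(* With [F = q m + r], [m g <= m (F - q) = (m - 1) F + r], and [r <= m - 1]. *)
have := divn_eq F m; have : (F %% m < m)%N by rewrite ltn_mod ltnW.
by nia.
Qed.

Theorem corollary41 (m g : nat) (hm : (2 <= m)%N) (hmg : (m <= g)%N) :
  Lhat m g = \bigcup_(F in Bset m g) LhatF m g F.
Proof.
apply/seteqP; split=> [S [nS mS gS]|S [F _ [nS mS gS _]]]; last by split.
have [m0 Sm minS] := mS.
(* As [m >= 2], the number 1 is a gap, so a largest gap exists and is a natural number. *)
have nS1 : ~ S 1%N by move=> /minS /(_ isT); rewrite leqNgt hm.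
have [F nSF maxF] := max_gap_exists _ _ nS nS1.
exists (Posz F); last by split=> //; apply: is_frobenius_nat.
split.
  have := max_gap_le_genus _ _ nS nSF.
  have := genus_add_div_le _ _ _ nS m0 Sm maxF.
  rewrite gS => gF Fg; apply/andP; split; first exact: ceil_div_sub1_le.
  by lia.
(* A multiple of [m] lies in [S], so the gap [F] cannot be one. *)
apply/negP; rewrite dvdzE => /dvdnP[k FE].
by apply: nSF; rewrite -[F]/(`|Posz F|%N) FE; apply: numerical_semigroupM.
Qed.
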